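(* Let $n,L,d\ge 2$ be integers with $L\le n$, let $E=\{e\subseteq [n]: |e|=L\}$ and $m=|E|=\binom{n}{L}$. Then the polynomial $$p_d(x)=\sum_{(e_1,\ldots,e_d)\in E^d}\frac{1}{|e_1\cup\cdots\cup e_d|}\,x_{e_1}\cdots x_{e_d}$$ in the variables $x=(x_e)_{e\in E}$ attains its global minimum over the standard simplex $\Delta_m$ at the barycenter $x^*=\frac1m(1,\ldots,1)$; that is, $p_d(x^* )\le p_d(x)$ for all $x\in\Delta_m$.
   Context: $[n]=\{1,\ldots,n\}$. The standard simplex is $\Delta_m=\{x=(x_e)_{e\in E}\in\mathbb R^m: x_e\ge 0 \text{ for all } e\in E,\ \sum_{e\in E}x_e=1\}$. *)

(* Defs.v *)
From mathcomp Require Import all_boot all_order all_algebra.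
From mathcomp Require Import reals.

Set Implicit Arguments.
Unset Strict Implicit.
Unset Printing Implicit Defensive.

Import Order.TTheory GRing.Theory Num.Theory.
Local Open Scope ring_scope.

(* The vertex set [n] = {1, ..., n} is represented by 'I_n. *)
Definition edge (n L : nat) : finType := {e : {set 'I_n} | #|e| == L}.

Lemma card_edge (n L : nat) : #|edge n L| = 'C(n, L).
Proof.
rewrite card_sig -[in RHS](card_ord n) -card_draws cardsE.
by apply: eq_card => A; rewrite !inE.
Qed.

Definition simplex (R : realType) (E : finType) (x : {ffun E -> R}) : Prop :=
  (forall e, 0 <= x e) /\ \sum_e x e = 1.

Definition barycenter (R : realType) (E : finType) : {ffun E -> R} :=
  [ffun=> (#|E|%:R)^-1].

(* The sum runs over ordered d-tuples of edges, repetitions allowed. *)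
Definition p_poly (R : realType) (n L d : nat) (x : {ffun edge n L -> R}) : R :=
  \sum_(e : {ffun 'I_d -> edge n L})
    (#|\bigcup_(k < d) val (e k)|%:R)^-1 * \prod_(k < d) x (e k).
Arguments p_poly {R n L} d x.

(* Main.v *)
Require Import Defs.
From mathcomp Require Import all_boot all_order all_algebra.
From mathcomp Require Import reals.
From mathcomp Require Import ring.

(* For a nonempty set U of vertices, 1/|U| is the sum of 1/(k C(n,k)), k = |W|,
   over all W containing U (this is 1/u = \int_0^1 t^(u-1) dt, where t^u is the
   probability that U lies in a t-random set W). Hence p_d is the sum over W of
   1/(k C(n,k)) f_W^d with f_W(x) = \sum_(e \subset W) x_e, a nonnegative
   combination of powers of nonnegative linear forms. Bounding each power below
   by its tangent at the barycenter, where f_W depends only on |W|, leaves a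
   linear form in x which is invariant under permutations of the vertices, hence
   constant on the simplex. *)

Import Order.TTheory GRing.Theory Num.Theory.
Local Open Scope ring_scope.

(** Supersets of [A] are the sets [A :|: B] with [B] inside the complement of [A]; grouping them by
    [#|B|] gives the binomial multiplicities. *)
Lemma sum_supersets (V : nmodType) (T : finType) (A : {set T}) (g : nat -> V) :
  \sum_(W : {set T} | A \subset W) g #|W| =
  \sum_(j < (#|~: A|).+1) g (#|A| + j)%N *+ 'C(#|~: A|, j).
Proof.
have inW (W : {set T}) : A \subset W -> A :|: (W :\: A) = W.
  by move=> /setIidPr {1}<-; rewrite setID.
rewrite (reindex_onto (fun B => A :|: B) (fun W => W :\: A)) /=; last first.
  by move=> W /inW.
rewrite (eq_bigl (fun B : {set T} => B \subset ~: A)); last first.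
  move=> B; rewrite subsetUl /= setDUl setDv set0U -disjoints_subset.
  exact/eqP/setDidPl.
rewrite (partition_big (fun B : {set T} => inord #|B| : 'I_(#|~: A|).+1)
           xpredT) //=.
apply: eq_bigr => j _; rewrite -cards_draws -sumr_const.
apply: eq_big => [B|B /andP[BA /eqP <-]].
  rewrite inE; case BA: (B \subset ~: A) => //=.
  by rewrite -val_eqE /= inordK // ltnS subset_leq_card.
rewrite inordK ?ltnS ?subset_leq_card //; congr g.
move: BA; rewrite subsetC -disjoints_subset -setI_eq0 => /eqP AB0.
by rewrite cardsU AB0 cards0 subn0.
Qed.

Lemma hockey_stick (v m : nat) :
  (\sum_(j < m.+1) 'C(v + j, v) = 'C((v + m).+1, v.+1))%N.
Proof.
elim: m => [|m IH]; first by rewrite big_ord1 addn0 !binn.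
by rewrite big_ord_recr /= IH addnS [RHS]binS.
Qed.

(** Put u = v+1, n = u+m, k = u+j. From C(n,k) C(k,u) = C(n,u) C(m,j) and k C(k-1,u-1) = u C(k,u),
    each term equals C(k-1,u-1) / (u C(n,u)); by [hockey_stick] the numerators add up to C(n,u). *)
Lemma inv_sum_bin (F : numFieldType) (v m : nat) :
  \sum_(j < m.+1)
    ((v.+1 + j)%:R * 'C(v.+1 + m, v.+1 + j)%:R)^-1 *+ 'C(m, j)
  = (v.+1%:R)^-1 :> F.
Proof.
have C_neq0 a b : (b <= a)%N -> 'C(a, b)%:R != 0 :> F.
  by move=> ba; rewrite pnatr_eq0 -lt0n bin_gt0.
transitivity (\sum_(j < m.+1)
    (v.+1%:R * 'C(v.+1 + m, v.+1)%:R)^-1 * 'C(v + j, v)%:R : F); last first.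
  rewrite -mulr_sumr -natr_sum hockey_stick addSn invfM mulfVK //.
  by apply: C_neq0; rewrite ltnS leq_addr.
apply: eq_bigr => j _; have jm : (j <= m)%N by rewrite -ltnS.
have diag : ((v.+1 + j) * 'C(v + j, v) = v.+1 * 'C(v.+1 + j, v.+1))%N.
  by rewrite addSn mul_bin_diag.
have trinomial : ('C(v.+1 + m, v.+1 + j) * 'C(v.+1 + j, v.+1)
                  = 'C(v.+1 + m, v.+1) * 'C(m, j))%N.
  (* Multiplying by these factorials turns both sides into (v+1+m)!. *)
  have fact_neq0 : (0 < v.+1`! * j`! * (m - j)`!)%N by rewrite !muln_gt0 !fact_gt0.
  apply/eqP; rewrite -(eqn_pmul2r fact_neq0); apply/eqP.
  have := @bin_fact (v.+1 + m) (v.+1 + j); rewrite leq_add2l subnDl => /(_ jm) E1.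
  have := @bin_fact (v.+1 + j) v.+1 (leq_addr _ _); rewrite addKn => E2.
  have := @bin_fact (v.+1 + m) v.+1 (leq_addr _ _); rewrite addKn => E3.
  have E4 := bin_fact jm.
  transitivity ((v.+1 + m)`!); last by rewrite -E3 -E4; ring.
  by rewrite -E1 -E2; ring.
move/(congr1 (fun k => k%:R : F)): diag; rewrite !natrM => diag.
move/(congr1 (fun k => k%:R : F)): trinomial; rewrite !natrM => trinomial.
have v0 : v.+1%:R != 0 :> F by rewrite pnatr_eq0.
have vj0 : (v.+1 + j)%:R != 0 :> F by rewrite pnatr_eq0.
have C1 : 'C(v.+1 + m, v.+1 + j)%:R != 0 :> F by rewrite C_neq0 ?leq_add2l.
have C2 : 'C(v.+1 + m, v.+1)%:R != 0 :> F by rewrite C_neq0 ?leq_addr.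
rewrite -[LHS]mulr_natl; apply: (mulfI (mulf_neq0 v0 C2)).
rewrite mulVKf ?mulf_neq0 //; apply: (mulIf (mulf_neq0 vj0 C1)).
rewrite [X in X * _]mulrA mulfVK ?mulf_neq0 //.
by rewrite -mulrA -trinomial mulrCA -diag; ring.
Qed.

(** For 1 <= k <= n this is the Beta integral of t^(k-1) (1-t)^(n-k) over [0,1]. At k = 0 the
    convention 0^-1 = 0 makes it vanish, so the empty set carries no weight. *)
Definition superset_weight (F : numFieldType) (n k : nat) : F :=
  (k%:R * 'C(n, k)%:R)^-1.
Arguments superset_weight {F} n k.

Lemma inv_card_superset_sum (F : numFieldType) (n : nat) (U : {set 'I_n}) :
  U != set0 ->
  (#|U|%:R)^-1 = \sum_(W : {set 'I_n} | U \subset W) superset_weight n #|W| :> F.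
Proof.
rewrite sum_supersets -card_gt0.
have := cardsC U; rewrite card_ord.
move: #|U| #|~: U| => [|v] // m <- _; exact/esym/inv_sum_bin.
Qed.

Lemma exprn_tangent (R : realDomainType) (a c : R) (d : nat) :
  0 <= a -> 0 <= c -> c ^+ d.+1 + d.+1%:R * c ^+ d * (a - c) <= a ^+ d.+1.
Proof.
move=> a0 c0; elim: d => [|d IH].
  by rewrite !expr1 expr0 !mul1r addrC subrK.
rewrite exprS [leRHS]exprS -subr_ge0.
(* The gap between power and tangent at the next exponent is [a] times the previous gap plus a
   nonnegative multiple of a square. *)
rewrite (_ : _ - _ = a * (a ^+ d.+1 - (c ^+ d.+1 + d.+1%:R * c ^+ d * (a - c)))
   + d.+1%:R * c ^+ d * (a - c) ^+ 2); last first.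
  by rewrite -[d.+2%:R]natr1 [c ^+ d.+1]exprS; ring.
apply: addr_ge0; first by rewrite mulr_ge0 // subr_ge0.
by rewrite mulr_ge0 ?sqr_ge0 // mulr_ge0 ?exprn_ge0 ?ler0n.
Qed.

Section EdgeSums.
Variables (R : realType) (n L : nat).
Implicit Types (x : {ffun edge n L -> R}) (W : {set 'I_n}).

Definition edge_sum x W : R := \sum_(e : edge n L | val e \subset W) x e.

(** After exchanging sums, a union of edges lies in [W] iff each edge does, so the sum over tuples
    factors into a power. *)
Lemma p_poly_edge_sum (d : nat) x : (0 < L)%N ->
  p_poly d.+1 x = \sum_(W : {set 'I_n}) superset_weight n #|W| * edge_sum x W ^+ d.+1.
Proof.
move=> L0; rewrite /p_poly.
transitivity (\sum_(e : {ffun 'I_d.+1 -> edge n L})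
   \sum_(W : {set 'I_n} | \bigcup_(k < d.+1) val (e k) \subset W)
     superset_weight n #|W| * \prod_(k < d.+1) x (e k)).
  apply: eq_bigr => e _; rewrite -mulr_suml inv_card_superset_sum //.
  (* The union is nonempty: it contains the edge of index [ord0], which has [L] > 0 vertices. *)
  rewrite -card_gt0; apply: leq_trans L0 _.
  rewrite -{1}(eqP (valP (e ord0))); apply: subset_leq_card.
  exact: (bigcup_sup ord0).
rewrite (exchange_big_dep xpredT) //=; apply: eq_bigr => W _.
rewrite -mulr_sumr; congr (_ * _).
rewrite -[in RHS](card_ord d.+1) -prodr_const bigA_distr_big /=.
apply: eq_bigl => e; apply/bigcupsP/ffun_onP => [sW k|sW k _]; exact: sW.
Qed.

Lemma edge_sum_barycenter W :
  edge_sum (barycenter R (edge n L)) W = 'C(#|W|, L)%:R / 'C(n, L)%:R.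
Proof.
rewrite /edge_sum (eq_bigr (fun=> 'C(n, L)%:R^-1)); last first.
  by move=> e _; rewrite ffunE card_edge.
rewrite sumr_const -[LHS]mulr_natl; congr (_%:R * _).
rewrite -cards_draws -(card_imset _ val_inj) /=.
apply: eq_card => A; rewrite inE; apply/imsetP/andP => [[e eW ->]|[AW AL]].
  by split; [exact: eW | exact: (valP e)].
by exists (Sub A AL : edge n L).
Qed.

(** The coefficient of [x e] is the sum of [g] over the supersets of [e], which is the same for all
    edges since they all have size [L]. *)
Lemma sum_weighted_edge_sum (g : nat -> R) x :
  \sum_(W : {set 'I_n}) g #|W| * edge_sum x W =
  (\sum_(j < (n - L).+1) g (L + j)%N *+ 'C(n - L, j)) * \sum_e x e.
Proof.
under eq_bigr do rewrite /edge_sum mulr_sumr.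
rewrite (exchange_big_dep xpredT) //= mulr_sumr; apply: eq_bigr => e _.
rewrite -mulr_suml sum_supersets (eqP (valP e)).
by rewrite cardsCs setCK card_ord (eqP (valP e)).
Qed.

Lemma barycenter_simplex : (L <= n)%N -> simplex (barycenter R (edge n L)).
Proof.
move=> Ln; split=> [e|]; first by rewrite ffunE invr_ge0 ler0n.
rewrite (eq_bigr (fun=> #|edge n L|%:R^-1)); last by move=> e _; rewrite ffunE.
rewrite sumr_const -[LHS]mulr_natl mulfV // pnatr_eq0 card_edge.
by rewrite -lt0n bin_gt0.
Qed.

End EdgeSums.
Arguments edge_sum {R n L} x W.

Theorem theorem1 (R : realType) (n L d : nat)
    (hn : (2 <= n)%N) (hL : (2 <= L)%N) (hd : (2 <= d)%N) (hLn : (L <= n)%N) :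
  simplex (barycenter R (edge n L)) /\
  (forall x : {ffun edge n L -> R}, simplex x ->
     p_poly d (barycenter R (edge n L)) <= p_poly d x).
Proof.
have [b0 b1] := barycenter_simplex R n L hLn; split=> // x [x0 x1].
case: d hd => // d _; rewrite !p_poly_edge_sum ?(ltnW hL) //.
set b := barycenter R (edge n L).
pose c k : R := 'C(k, L)%:R / 'C(n, L)%:R.
pose g k : R := superset_weight n k * (d.+1%:R * c k ^+ d).
(* The slopes [g] depend on [#|W|] only, so the linear terms of the tangents take the same total at
   both points, whose coordinates sum to 1. *)
have tangent0 : \sum_(W : {set 'I_n}) g #|W| * (edge_sum x W - edge_sum b W) = 0.
  under eq_bigr do rewrite mulrBr.
  by rewrite sumrB !sum_weighted_edge_sum x1 b1 subrr.
(* With 0 replaced by this sum, the tangent inequality can be applied to each [W] separately. *)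
rewrite -subr_ge0 -sumrB -[leLHS]tangent0; apply: ler_sum => W _.
rewrite /g -mulrA -mulrBr /c -edge_sum_barycenter.
apply: ler_wpM2l; first by rewrite invr_ge0 mulr_ge0 ?ler0n.
rewrite lerBrDl; apply: exprn_tangent; apply: sumr_ge0 => e _.
  exact: x0.
exact: b0.
Qed.
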